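(* Let $n\ge1$. The quiver $Q$ of the initial seed of $\mathrm{Conf}_3^\times(\widetilde{\mathcal F\ell})$ has a maximal green sequence, and therefore the cluster variety $\mathrm{Conf}_3^\times(\widetilde{\mathcal F\ell})$ has large cluster complex.
   Context: **Quiver.** $\mathcal H=\{(a,b,c)\in\mathbb Z_{\ge0}^3:a+b+c=n\}$; a vertex is unfrozen if $a,b,c>0$, else frozen; $I_{\rm uf}$ is the set of unfrozen ones. $Q$ has vertex set $\mathcal H$ and an arrow from $(a,b,c)$ to each of $(a-1,b+1,c),(a,b-1,c+1),(a+1,b,c-1)$ in $\mathcal H$, arrows between two frozen vertices being omitted. It is the quiver of the Fock–Goncharov initial seed of the cluster $\mathcal A$-variety $\mathrm{Conf}_3^\times(\widetilde{\mathcal F\ell})$, the space of triples of decorated flags for $\mathrm{GL}_n$, up to the diagonal action, whose underlying flags are pairwise generic. **Maximal green sequence.** The framed quiver $\widehat Q$ is $Q$ together with a new frozen vertex $w_i$ for each vertex $v_i$ and an arrow $v_i\to w_i$ for each unfrozen $v_i$. In a quiver obtained from $\widehat Q$ by mutations at unfrozen vertices, an unfrozen $v_i$ is green if all arrows between $v_i$ and the $w_j$ go out of $v_i$, and red if all such arrows go into $v_i$ (every unfrozen vertex is one or the other). A maximal green sequence is a finite sequence of quiver mutations starting from $\widehat Q$, each at a green unfrozen vertex, after which every unfrozen vertex is red. **Large cluster complex.** On $\mathbb Z^{\mathcal H}$ with basis $e_i$ let $\{e_i,e_j\}=\#(i\to j)-\#(j\to i)$; $N=\mathbb Z^{\mathcal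 H}/\mathbb Z\mathbf 1$ with $\mathbf 1$ the all-ones vector, $M=\mathrm{Hom}(N,\mathbb Z)=\{m\in\mathbb Z^{\mathcal H}:\sum m_i=0\}$. The initial seed is $s_0=(e_i)$; mutation at unfrozen $k$ of a seed $s=(e_i)$ gives $\mu_k(s)=(e_i')$ with $e_k'=-e_k$, $e_i'=e_i+[\{e_i,e_k\}]_+e_k$ ($i\ne k$), $[x]_+=\max\{0,x\}$. The tropical space $\mathrm{Conf}_3^\times(\widetilde{\mathcal F\ell})^\vee(\mathbb R^T)$ of the Fock–Goncharov dual is identified with $M_{\mathbb R}$ by each seed, the identifications for $s$ and $\mu_k(s)$ being related by the piecewise linear bijection $x\mapsto x+[\langle e_k,x\rangle]_+\{e_k,\cdot\}$, with $e_k$ in $s$. The cluster complex is the collection of cones, one for each seed $s$ obtained from $s_0$ by finitely many mutations, which under the identification by $s$ is $\{x:\langle e_{i;s},x\rangle\ge0\ \forall i\in I_{\rm uf}\}$. The cluster variety has large cluster complex if, for some seed, the union of the cones of the cluster complex, viewed in $M_{\mathbb R}$ via that seed, is not contained in a half-space. *)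

(* Defs.v *)
From HB Require Import structures.
From mathcomp Require Import all_boot all_order all_algebra.
From mathcomp Require Import classical_sets reals.

Set Implicit Arguments.
Unset Strict Implicit.
Unset Printing Implicit Defensive.

Import Order.TTheory GRing.Theory Num.Theory.

Local Open Scope classical_set_scope.
Local Open Scope ring_scope.

(* [arr Q i j] is the number of arrows from [i] to [j]. *)
Record ice_quiver (V : Type) := IceQuiver {
  unfrozen : pred V;
  arr : V -> V -> nat
}.

(* Away from [k], one adds an arrow i -> j for each path i -> k -> j and
   cancels 2-cycles: the truncated subtraction is what survives of the arrows
   i -> j.  Arrows between two frozen vertices are discarded. *)
Definition quiver_mutation (V : eqType) (Q : ice_quiver V) (k : V) :
    ice_quiver V :=
  IceQuiver (unfrozen Q) (fun i j =>
    if (i == k) || (j == k) then arr Q j i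
    else if unfrozen Q i || unfrozen Q j then
      ((arr Q i j + arr Q i k * arr Q k j)
       - (arr Q j i + arr Q j k * arr Q k i))%N
    else 0%N).

(* [inl i] is the vertex v_i of [Q], [inr i] its frozen copy w_i. *)
Definition framed (V : eqType) (Q : ice_quiver V) : ice_quiver (V + V)%type :=
  IceQuiver
    (fun v => if v is inl i then unfrozen Q i else false)
    (fun u v =>
       match u, v with
       | inl i, inl j => arr Q i j
       | inl i, inr j => nat_of_bool ((i == j) && unfrozen Q i)
       | inr _, _ => 0%N
       end).

Definition green (V : eqType) (P : ice_quiver (V + V)%type) (i : V) : Prop :=
  forall j : V, arr P (inr j) (inl i) = 0%N.

Definition red (V : eqType) (P : ice_quiver (V + V)%type) (i : V) : Prop :=
  forall j : V, arr P (inl i) (inr j) = 0%N.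

Fixpoint maximal_green_from (V : eqType) (P : ice_quiver (V + V)%type)
    (ks : seq V) : Prop :=
  match ks with
  | [::] => forall i, unfrozen P (inl i) -> red P i
  | k :: ks' => [/\ unfrozen P (inl k), green P k
                  & maximal_green_from (quiver_mutation P (inl k)) ks']
  end.

Definition maximal_green_sequence (V : eqType) (Q : ice_quiver V)
    (ks : seq V) : Prop :=
  maximal_green_from (framed Q) ks.

Definition triangle (n : nat) : finType :=
  {p : 'I_n.+1 * 'I_n.+1 * 'I_n.+1 | (p.1.1 + p.1.2 + p.2 == n)%N}.

Definition coord_a (n : nat) (v : triangle n) : nat := (val v).1.1.
Definition coord_b (n : nat) (v : triangle n) : nat := (val v).1.2.
Definition coord_c (n : nat) (v : triangle n) : nat := (val v).2.

Definition triangle_unfrozen (n : nat) (v : triangle n) : bool :=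
  [&& (0 < coord_a v)%N, (0 < coord_b v)%N & (0 < coord_c v)%N].

(* The three disjuncts are the arrows from (a,b,c) to (a-1,b+1,c), to
   (a,b-1,c+1) and to (a+1,b,c-1). *)
Definition triangle_arrow (n : nat) (u v : triangle n) : bool :=
  [|| [&& coord_a u == (coord_a v).+1, coord_b v == (coord_b u).+1
        & coord_c v == coord_c u],
      [&& coord_a v == coord_a u, coord_b u == (coord_b v).+1
        & coord_c v == (coord_c u).+1]
    | [&& coord_a v == (coord_a u).+1, coord_b v == coord_b u
        & coord_c u == (coord_c v).+1]].

Definition conf3_quiver (n : nat) : ice_quiver (triangle n) :=
  IceQuiver (@triangle_unfrozen n) (fun u v =>
    nat_of_bool ((triangle_unfrozen u || triangle_unfrozen v)
                 && triangle_arrow u v)).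

(* Elements of N = Z^V / Z 1 are given by representatives in Z^V.  For the
   quivers above, {1, e_k} = 0 for every unfrozen k, so that the mutations and
   the pairing with M below only depend on the classes modulo 1. *)

Definition lattice_basis (V : finType) (i : V) : {ffun V -> int} :=
  [ffun j => (i == j)%:R].

Definition skew_form (V : finType) (Q : ice_quiver V)
    (u v : {ffun V -> int}) : int :=
  \sum_i \sum_j u i * v j * ((arr Q i j)%:Z - (arr Q j i)%:Z).

Definition seed (V : finType) := V -> {ffun V -> int}.

Definition initial_seed (V : finType) : seed V := @lattice_basis V.

Definition seed_mutation (V : finType) (Q : ice_quiver V) (s : seed V)
    (k : V) : seed V :=
  fun i => if i == k then - s k
           else s i + s k *~ Num.max 0 (skew_form Q (s i) (s k)).

(* M_R = { m in R^V : sum m_i = 0 }, the dual of N_R. *)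
Definition MR (R : realType) (V : finType) : set {ffun V -> R} :=
  [set x | \sum_i x i = 0].

Definition pairing (R : realType) (V : finType) (u : {ffun V -> int})
    (x : {ffun V -> R}) : R :=
  \sum_i (u i)%:~R * x i.

(* From the coordinate of a tropical point in the seed [s] to its coordinate
   in the seed mu_k(s). *)
Definition trop_mutation (R : realType) (V : finType) (Q : ice_quiver V)
    (s : seed V) (k : V) (x : {ffun V -> R}) : {ffun V -> R} :=
  [ffun j => x j + Num.max 0 (pairing (s k) x)
                   * (skew_form Q (s k) (lattice_basis j))%:~R].

(* The seed reached from [s] by mutating along [ks], head first. *)
Definition seed_mutations (V : finType) (Q : ice_quiver V) (s : seed V)
    (ks : seq V) : seed V :=
  foldl (seed_mutation Q) s ks.

(* From the coordinate of a tropical point in [s] to its coordinate in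
   [seed_mutations Q s ks]. *)
Fixpoint trop_mutations (R : realType) (V : finType) (Q : ice_quiver V)
    (s : seed V) (ks : seq V) (x : {ffun V -> R}) : {ffun V -> R} :=
  if ks is k :: ks' then
    trop_mutations Q (seed_mutation Q s k) ks' (trop_mutation Q s k x)
  else x.

Definition seed_cone (R : realType) (V : finType) (Q : ice_quiver V)
    (s : seed V) : set {ffun V -> R} :=
  [set x | MR x /\ forall i, unfrozen Q i -> 0 <= pairing (s i) x].

(* The cone of the cluster complex attached to the seed reached from the
   initial one along [ls], in the coordinates of the initial seed. *)
Definition cluster_cone (R : realType) (V : finType) (Q : ice_quiver V)
    (ls : seq V) : set {ffun V -> R} :=
  [set x | MR x /\ seed_cone Q (seed_mutations Q (@initial_seed V) ls)
                     (trop_mutations Q (@initial_seed V) ls x)].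

(* The union of all cones, viewed in M_R via the seed reached from the initial
   one along [ks]. *)
Definition cluster_complex_support (R : realType) (V : finType)
    (Q : ice_quiver V) (ks : seq V) : set {ffun V -> R} :=
  trop_mutations Q (@initial_seed V) ks @`
    (\bigcup_(ls in [set ls | all (unfrozen Q) ls]) @cluster_cone R V Q ls).

(* A half-space of M_R is cut out by a linear form that does not vanish on
   M_R, given here by its coefficients [f]. *)
Definition half_space (R : realType) (V : finType) (H : set {ffun V -> R}) :
    Prop :=
  exists (f : {ffun V -> R}) (c : R),
    (exists2 x, MR x & \sum_i f i * x i != 0) /\
    H = [set x | MR x /\ c <= \sum_i f i * x i].

Definition large_cluster_complex (R : realType) (V : finType)
    (Q : ice_quiver V) : Prop :=
  exists2 ks, all (unfrozen Q) ks &
    ~ exists2 H, half_space H & @cluster_complex_support R V Q ks `<=` H.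

(* Main.v *)
Require Import Defs.
From mathcomp Require Import all_boot all_order all_algebra.
From mathcomp Require Import classical_sets reals.
From mathcomp Require Import zify ring.

(* Write a vertex as (a,b) (with c = n - a - b) and group the unfrozen vertices
   in rows of constant c.  The sequence mutates (a,b) exactly b times, in any
   order for which the numbers h(a,b) of mutations done so far form a stepped
   surface: h(a,b) - h(a+1,b-1) and h(a,b+1) - h(a,b) stay in {0,1}.  These are
   the moves of the octahedron recurrence.  At each stage the arrows between
   unfrozen vertices are affine functions of h, and (a,b) may be mutated when it
   has its two row neighbours as only in-neighbours and (a,b-1), (a,b+1) as only
   out-neighbours.  Hence mutations never mix the c-vectors of different rows,
   and the c-vector of (a,b) is a difference of two indicators of initial
   intervals, attached to the row edges on both sides of (a,b); a mutation
   swaps these two indicators.  An unfinished vertex minimizing 2 h(a,b) - b can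
   always be mutated, and is green; when h(a,b) = b everywhere, all c-vectors
   are negative.

   Along green mutations, the seed vectors are the c-vectors, so that they are
   nonnegative on the vertices being mutated.  On the opposite C- of the initial
   cone C+ all tropical mutations are then the identity, and since the final
   c-vectors are negative the final cone contains C-.  A half-space containing
   C+ and C- is cut out by a form vanishing on C+, which spans M_R. *)

Set Implicit Arguments.
Unset Strict Implicit.
Unset Printing Implicit Defensive.

Import Order.TTheory GRing.Theory Num.Theory.

Local Open Scope ring_scope.

(** * Net arrows and seeds along green mutations *)

Section NetArrows.
Variable V : eqType.
Implicit Types (P : ice_quiver V) (i j k : V).

Definition net P i j : int := (arr P i j)%:Z - (arr P j i)%:Z.

Definition no_two_cycles P := forall i j, arr P i j = 0%N \/ arr P j i = 0%N.

Lemma netC P i j : net P j i = - net P i j.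
Proof. by rewrite /net opprB. Qed.

Lemma arr_max_net P i j : no_two_cycles P -> (arr P i j)%:Z = Num.max 0 (net P i j).
Proof. by rewrite /net => /(_ i j); lia. Qed.

Lemma no_two_cycles_mutation P k :
  no_two_cycles P -> no_two_cycles (quiver_mutation P k).
Proof.
move=> H i j; rewrite /= orbC [unfrozen P j || _]orbC.
by case: ifP => _; [exact: H|case: ifP => _; lia].
Qed.

Lemma net_mutation P k i j : no_two_cycles P -> unfrozen P i || unfrozen P j ->
  net (quiver_mutation P k) i j =
  if (i == k) || (j == k) then - net P i j
  else net P i j + Num.max 0 (net P i k) * Num.max 0 (net P k j)
                 - Num.max 0 (net P j k) * Num.max 0 (net P k i).
Proof.
move=> H uij; rewrite -!arr_max_net // /net /=.
rewrite [(j == k) || _]orbC [unfrozen P j || _]orbC uij.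
case: ifP => _; first by rewrite opprB.
have [] := H i j; lia.
Qed.

End NetArrows.

Lemma no_two_cycles_framed (V : eqType) (Q : ice_quiver V) :
  no_two_cycles Q -> no_two_cycles (framed Q).
Proof. by move=> H [i|i] [j|j] /=; [exact: H|right|left|left]. Qed.

(* On green mutations, the rule for the vectors of a seed agrees with the rule
   for the arrows to the frozen copies. *)
Section GreenSeeds.
Variables (V : finType) (Q : ice_quiver V).
Hypothesis Q2 : no_two_cycles Q.
Implicit Types (P : ice_quiver (V + V)%type) (s : seed V).

Lemma ffunMzE (u : {ffun V -> int}) (z : int) i : (u *~ z) i = u i * z.
Proof.
rewrite -mulrzz.
by case: z => n; rewrite ?NegzE ?mulrNz ?ffunE -!pmulrn ffunMnE.
Qed.

Lemma skew_formDMl u v w (z : int) :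
  skew_form Q (u + v *~ z) w = skew_form Q u w + z * skew_form Q v w.
Proof.
rewrite /skew_form big_distrr -big_split; apply: eq_bigr => i _ /=.
rewrite big_distrr -big_split; apply: eq_bigr => j _ /=.
by rewrite ffunE ffunMzE; ring.
Qed.

Lemma skew_formNl u v : skew_form Q (- u) v = - skew_form Q u v.
Proof.
rewrite /skew_form -sumrN; apply: eq_bigr => i _.
by rewrite -sumrN; apply: eq_bigr => j _; rewrite ffunE; ring.
Qed.

Lemma skew_formC u v : skew_form Q v u = - skew_form Q u v.
Proof.
rewrite /skew_form exchange_big -sumrN; apply: eq_bigr => i _.
by rewrite -sumrN; apply: eq_bigr => j _; ring.
Qed.

Lemma skew_form_basis i j :
  skew_form Q (lattice_basis i) (lattice_basis j) = net Q i j.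
Proof.
rewrite /skew_form (bigD1 i) //= [X in _ + X]big1 ?addr0; last first.
  by move=> x xi; rewrite big1 // => y _; rewrite ffunE eq_sym (negPf xi) !mul0r.
rewrite (bigD1 j) //= [X in _ + X]big1 ?addr0; last first.
  by move=> x xj; rewrite !ffunE [j == x]eq_sym (negPf xj) mulr0 mul0r.
by rewrite !ffunE !eqxx !mul1r.
Qed.

Definition seed_agrees P s : Prop :=
  [/\ no_two_cycles P,
      forall i, unfrozen P (inl i) = unfrozen Q i,
      forall i j, unfrozen Q i -> s i j = net P (inl i) (inr j),
      forall i j, unfrozen Q i -> unfrozen Q j ->
        skew_form Q (s i) (s j) = net P (inl i) (inl j)
    & forall i j, unfrozen Q i -> ~~ unfrozen Q j -> s i j = 0].

Lemma seed_agrees_framed : seed_agrees (framed Q) (@initial_seed V).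
Proof.
split=> //.
- exact: no_two_cycles_framed.
- by move=> i j ui; rewrite ffunE /net /= ui andbT subr0; case: (i == j).
- by move=> i j _ _; rewrite skew_form_basis.
- by move=> i j ui; rewrite ffunE; case: eqP => // <-; rewrite ui.
Qed.

(** Since k is green, only paths i -> k -> w_j create arrows to frozen copies: the c-vector of i
    gains [net i k]_+ times that of k, as in [seed_mutation]. *)
Lemma seed_agrees_mutation P s k :
  seed_agrees P s -> unfrozen Q k -> green P k ->
  seed_agrees (quiver_mutation P (inl k)) (seed_mutation Q s k).
Proof.
case=> P2 uP sC sB s0 uk gk.
have c_ge0 j : 0 <= net P (inl k) (inr j) by rewrite /net gk subr0.
have einl a b : (inl a == inl b :> V + V) = (a == b) by [].
split=> //.
- exact: no_two_cycles_mutation.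
- move=> i j ui; rewrite net_mutation //= ?uP ?ui // orbF einl /seed_mutation.
  case: eqP => [->|_]; first by rewrite ffunE sC.
  rewrite ffunE ffunMzE !sC // sB // [net P (inr j) _]netC.
  rewrite (max_r (c_ge0 j)) (max_l (_ : - _ <= 0)) ?oppr_le0 //.
  by rewrite mul0r subr0 mulrC.
- move=> i j ui uj; rewrite net_mutation //= ?uP ?ui // !einl /seed_mutation.
  have skk : skew_form Q (s k) (s k) = 0 by rewrite sB // /net subrr.
  have [->|_] := eqP; have [->|_] := eqP.
  + by rewrite skew_formNl skew_formC skew_formNl skk /net subrr.
  + rewrite skew_formNl skew_formC skew_formDMl skk mulr0 addr0.
    by rewrite -skew_formC sB.
  + rewrite skew_formC skew_formNl opprK skew_formC skew_formDMl skk.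
    by rewrite mulr0 addr0 sB.
  + rewrite skew_formDMl [skew_form Q (s i) (_ + _)]skew_formC.
    rewrite [skew_form Q (s k) (_ + _)]skew_formC !skew_formDMl skk mulr0 addr0.
    rewrite !sB // ![net P (inl j) _]netC [net P (inl k) (inl i)]netC.
    (* Splitting both factors into positive and negative parts cancels the product of the positive
       parts of i -> k and j -> k and leaves the mutation rule. *)
    have posneg (x : int) : x = Num.max 0 x - Num.max 0 (- x) by lia.
    rewrite /= {1}(posneg (net P (inl i) (inl k))).
    by rewrite {2}(posneg (net P (inl k) (inl j))); ring.
- move=> i j ui uj; rewrite /seed_mutation; case: ifP => _.
    by rewrite ffunE s0 ?oppr0.
  by rewrite ffunE ffunMzE !s0 // mul0r.
Qed.
End GreenSeeds.

(** * From a maximal green sequence to a large cluster complex *)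

Section LargeComplex.
Variables (R : realType) (V : finType) (Q : ice_quiver V).
Hypothesis Q2 : no_two_cycles Q.
Implicit Types (P : ice_quiver (V + V)%type) (s : seed V) (x : {ffun V -> R}).

Lemma trop_mutations_nonpos ks : forall P s x,
  seed_agrees Q P s -> maximal_green_from P ks ->
  (forall i, unfrozen Q i -> x i <= 0) ->
  [/\ all (unfrozen Q) ks, trop_mutations Q s ks x = x
    & forall i, unfrozen Q i -> 0 <= pairing (seed_mutations Q s ks i) x].
Proof.
elim: ks => [|k ks IHks] P s x Ps mP x0 /=.
  have [_ uP sC _ s0] := Ps.
  split=> // i ui; apply: sumr_ge0 => j _.
  have [uj|uj] := boolP (unfrozen Q j); last by rewrite s0 // mul0r.
  apply: mulr_le0 (x0 j uj); rewrite sC // lerz0 /net.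
  by rewrite (mP i) ?uP // sub0r oppr_le0.
have [uk gk mP'] := mP; have [_ uP sC _ s0] := Ps.
rewrite uP in uk; rewrite uk.
have -> : trop_mutation Q s k x = x.
  apply/ffunP => j; rewrite ffunE max_l ?mul0r ?addr0 //.
  apply: sumr_le0 => i _.
  have [ui|ui] := boolP (unfrozen Q i); last by rewrite s0 // mul0r.
  apply: mulr_ge0_le0 (x0 i ui); rewrite sC // ler0z /net.
  by rewrite (gk i) subr0.
exact: IHks _ _ _ (seed_agrees_mutation Ps uk gk) mP' x0.
Qed.

(* The cone of the seed at the end of the sequence contains the opposite of
   the initial cone. *)
Lemma maximal_green_sequence_large ks f :
  ~~ unfrozen Q f -> maximal_green_sequence Q ks -> large_cluster_complex R Q.
Proof.
move=> uf mQ; exists [::] => // -[H [g [c [[x0 x0M gx0] ->]]] supp].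
pose dot (x : {ffun V -> R}) := \sum_i g i * x i.
(* The whole line through a point of C+ lies in the support: nonnegative multiples are in C+,
   negative ones in the final cone. *)
have ray (x : {ffun V -> R}) (t : R) : MR x ->
    (forall i, unfrozen Q i -> 0 <= x i) -> c <= t * dot x.
  move=> xM xge0; pose tx := [ffun i => t * x i].
  have txM : MR tx.
    rewrite /MR /=; under eq_bigr do rewrite ffunE.
    by rewrite -mulr_sumr xM mulr0.
  suff : cluster_complex_support Q [::] tx.
    move=> /supp[_]; congr (_ <= _); rewrite /dot mulr_sumr.
    by apply: eq_bigr => i _; rewrite ffunE mulrCA.
  exists tx => //; have [t0|t0] := lerP 0 t.
    exists [::] => //; split=> //; split=> // i ui.
    apply: sumr_ge0 => j _; rewrite !ffunE.
    case: eqP => [<-|_]; last by rewrite mul0r.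
    by rewrite mul1r mulr_ge0 ?xge0.
  have tx0 i : unfrozen Q i -> tx i <= 0.
    by move=> ui; rewrite ffunE nmulr_rle0 ?xge0.
  have [uks tks sks] := trop_mutations_nonpos (seed_agrees_framed Q2) mQ tx0.
  by exists ks => //; split=> //; rewrite /seed_cone /= tks.
have dot0 (x : {ffun V -> R}) : MR x ->
    (forall i, unfrozen Q i -> 0 <= x i) -> dot x = 0.
  move=> xM xge0; apply/eqP/negPn/negP => gx.
  (* At this multiple of x the form takes the value c - 1, below the bound. *)
  have := ray x ((c - 1) / dot x) xM xge0.
  by rewrite divfK // lerBrDr gerDl ler10.
(* x0 is y - (y - x0) with both terms in C+: y has the positive parts of x0 at unfrozen vertices,
   and its frozen coordinate [f] makes the sum vanish. *)
pose y0 := [ffun i => if unfrozen Q i then Num.max 0 (x0 i) else 0].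
pose y := [ffun i => if i == f then - \sum_j y0 j else y0 i].
have yM : MR y.
  rewrite /MR /= (bigD1 f) //= ffunE eqxx (bigD1 f) //=.
  rewrite {1}ffunE (negPf uf) add0r addrC; apply/eqP; rewrite subr_eq0; apply/eqP.
  by apply: eq_bigr => i /negPf fi; rewrite ffunE fi.
have yu i : unfrozen Q i -> y i = Num.max 0 (x0 i).
  move=> ui; rewrite !ffunE ui; case: eqP => // ei.
  by move: uf; rewrite -ei ui.
have zM : MR (y - x0).
  rewrite /MR /= (eq_bigr (fun i => y i - x0 i)) => [|i _]; last by rewrite !ffunE.
  by rewrite sumrB (yM : \sum_i y i = 0) x0M subr0.
move/eqP: gx0; apply.
have <- : dot y - dot (y - x0) = \sum_i g i * x0 i.
  rewrite -sumrB; apply: eq_bigr => i _; rewrite !ffunE; ring.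
have zu i : unfrozen Q i -> 0 <= (y - x0) i.
  move=> ui; have -> : (y - x0) i = y i - x0 i by rewrite !ffunE.
  by rewrite yu // subr_ge0 le_max lexx orbT.
by rewrite !dot0 ?subr0 // => i ui; rewrite yu // le_max lexx.
Qed.
End LargeComplex.

(** * Stepped surfaces and their quivers *)

Section Heights.
Variable n : nat.
Implicit Types h : nat -> nat -> nat.

(* [h a b] is only meaningful for 0 < a and a + b < n; the boundary value
   h(a,0) = 0 lets the vertices with b = 1 behave like the others. *)
Definition admissible h : Prop :=
  [/\ forall a, h a 0%N = 0%N,
      forall a b, (0 < a)%N -> (0 < b)%N -> (a + b < n)%N -> (h a b <= b)%N,
      forall a b, (0 < a)%N -> (0 < b)%N -> (a + b < n)%N ->
        (h a.+1 b.-1 <= h a b <= (h a.+1 b.-1).+1)%N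
    & forall a b, (0 < a)%N -> (a + b.+1 < n)%N ->
        (h a b <= h a b.+1 <= (h a b).+1)%N].

(** The local shape at which an octahedron move applies. A neighbour (a-1,b+1) or (a,b+1) outside
    the unfrozen region imposes nothing. *)
Definition raisable h a b : Prop :=
  [/\ (0 < a)%N, (0 < b)%N, (a + b < n)%N & (h a b < b)%N] /\
  [/\ h a.+1 b.-1 = h a b, h a b.-1 = h a b,
      (1 < a)%N -> h a.-1 b.+1 = (h a b).+1
    & (a + b.+1 < n)%N -> h a b.+1 = (h a b).+1].

Definition raise h a b : nat -> nat -> nat :=
  fun x y => (h x y + ((x == a) && (y == b)))%N.

Lemma admissible_raise h a b :
  admissible h -> raisable h a b -> admissible (raise h a b).
Proof.
move=> [h0 hb hh hv] [[a0 b0 ab lt] [e1 e2 e3 e4]]; rewrite /raise; split.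
- by move=> x; rewrite h0; lia.
- move=> x y x0 y0 xy; have := hb x y x0 y0 xy.
  have [-> /=|_] := eqVneq x a; last by rewrite /= addn0.
  by have [-> /=|_] := eqVneq y b; lia.
- move=> x y x0 y0 xy; have := hh x y x0 y0 xy.
  have [[-> ->]|N] := altP (@eqP _ (x, y) (a, b)); first by rewrite e1; lia.
  have [[ex ey]|N'] := altP (@eqP _ (x.+1, y.-1) (a, b)).
    have -> : x = a.-1 by lia.
    have -> : y = b.+1 by lia.
    by rewrite e3 ?prednK //=; lia.
  by move: N N'; rewrite !xpair_eqE; lia.
- move=> x y x0 xy; have := hv x y x0 xy.
  have [[ex ey]|N] := altP (@eqP _ (x, y) (a, b)); first by subst x y; rewrite e4 //; lia.
  have [[ex ey]|N'] := altP (@eqP _ (x, y.+1) (a, b)).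
    have -> : y = b.-1 by lia.
    by rewrite ex prednK // e2; lia.
  by move: N N'; rewrite !xpair_eqE; lia.
Qed.

(** Each slope has two possible values; the wrong one would give an unfinished neighbour with a
    smaller value of 2h - b. *)
Lemma raisable_min h a b : admissible h ->
  (0 < a)%N -> (0 < b)%N -> (a + b < n)%N -> (h a b < b)%N ->
  (forall x y, (0 < x)%N -> (0 < y)%N -> (x + y < n)%N -> (h x y < y)%N ->
     (2 * h a b + y <= 2 * h x y + b)%N) ->
  raisable h a b.
Proof.
move=> [h0 hb hh hv] a0 b0 ab lt min; split=> //; split.
- have /andP[lo hi] := hh a b a0 b0 ab.
  have [b1|b1] := leqP b 1; first by rewrite (_ : b.-1 = 0%N) ?h0; lia.
  by have := min a.+1 b.-1; lia.
- have := hv a b.-1 a0; rewrite prednK // => /(_ ab).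
  have [b1|b1] := leqP b 1; first by rewrite (_ : b.-1 = 0%N) ?h0; lia.
  by have := min a b.-1; lia.
- by move=> a1; have := hh a.-1 b.+1; have := min a.-1 b.+1; rewrite prednK //=; lia.
- by move=> ab1; have := hv a b a0 ab1; have := min a b.+1; lia.
Qed.
End Heights.

Ltac decide_bools := repeat match goal with |- context [nat_of_bool ?b] =>
  lazymatch b with true => fail | false => fail
  | _ => first [have -> : b = false by lia | have -> : b = true by lia] end end;
  rewrite /= ?mul0r ?mul1r ?add0r ?addr0.

(** * Arrows and c-vectors as functions of the heights *)

Section Arrows.
Variable n : nat.
Implicit Types h : nat -> nat -> nat.

(* The four terms are the possible arrows from (a,b) to (x,y), or their
   opposites, along a row edge, a column edge (a = x), and the two diagonals of
   the square (a,b), (a+1,b-1), (a,b+1), (a+1,b) of the stepped surface. *)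
Definition half_net h (a b x y : nat) : int :=
  ((a == x.+1) && (y == b.+1))%:Z * (1 - ((h x y)%:Z - (h a b)%:Z) *+ 2)
  + ((a == x) && (b == y.+1))%:Z * (1 - ((h a b)%:Z - (h x y)%:Z) *+ 2)
  + ((x == a.+1) && (y == b))%:Z * (1 - (h a b.+1)%:Z + (h x b.-1)%:Z)
  + ((x == a.+1) && (b == y.+2))%:Z * ((h x y.+1)%:Z - (h a y.+1)%:Z).

Definition height_net h a b x y : int :=
  half_net h a b x y - half_net h x y a b.

Lemma height_netC h a b x y : height_net h a b x y = - height_net h x y a b.
Proof. by rewrite /height_net opprB. Qed.

Definition in_neighbor (a b x y : nat) : bool :=
  ((x == a.+1) && (y.+1 == b)) || ((x.+1 == a) && (y == b.+1)).

Definition out_neighbor (a b x y : nat) : bool :=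
  (x == a) && ((y == b.+1) || (y.+1 == b)).

(** The forced heights around (a,b) make the diagonal coefficients at (a,b) vanish and the row and
    column ones equal to 1 or -1. *)
Lemma height_net_raisable h a b x y : raisable n h a b ->
  (0 < x)%N -> (0 < y)%N -> (x + y < n)%N ->
  height_net h x y a b = (in_neighbor a b x y)%:Z - (out_neighbor a b x y)%:Z.
Proof.
(* From here on the vertex is ([a.+1], [b.+1]), so its neighbours lie in the columns [a], [a.+1] and
   [a.+2]. *)
move=> [[]]; case: a b => [//|a] [//|b] _ _ ab lt [e1 e2 e3 e4] x0 y0 xy.
rewrite /height_net /half_net /in_neighbor /out_neighbor /=.
rewrite /= in e1 e2 e3.
have [ex|x1] := eqVneq x a.
  subst x; rewrite -ltnS in x0; have {}e3 := e3 x0.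
  have [->|y1] := eqVneq y b.+2; first by decide_bools; lia.
  have [->|y2] := eqVneq y b.+1; first by decide_bools; lia.
  have [ey|y3] := eqVneq y b.+3; first by subst y; decide_bools; have := e4; lia.
  by decide_bools; lia.
have [ex|x2] := eqVneq x a.+1.
  subst x.
  have [ey|y1] := eqVneq y b.+2; first by subst y; decide_bools; have := e4; lia.
  have [ey|y2] := eqVneq y b; first by subst y; decide_bools; lia.
  by decide_bools; lia.
have [ex|x3] := eqVneq x a.+2.
  subst x.
  have [ey|y1] := eqVneq y b; first by subst y; decide_bools; lia.
  have [ey|y2] := eqVneq y b.+1; first by subst y; decide_bools; have := e4; lia.
  have [ey|y3] := eqVneq y.+1 b; first by subst b; decide_bools; lia.
  by decide_bools; lia.
by decide_bools; lia.
Qed.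

(** The endpoints keep their heights, so only the diagonal coefficients change: they read the two
    other corners of the square. *)
Lemma half_net_raise h a b x y z w :
  ((x == a) && (y == b)) = false -> ((z == a) && (w == b)) = false ->
  half_net (raise h a b) x y z w = half_net h x y z w
  - ((z == x.+1) && (w == y))%:Z * ((x == a) && (y.+1 == b))%:Z
  + ((z == x.+1) && (w == y))%:Z * ((z == a) && (y.-1 == b))%:Z
  + ((z == x.+1) && (y == w.+2))%:Z * ((z == a) && (w.+1 == b))%:Z
  - ((z == x.+1) && (y == w.+2))%:Z * ((x == a) && (w.+1 == b))%:Z.
Proof.
by move=> xy zw; rewrite /half_net /raise xy zw !addn0 !PoszD; ring.
Qed.

(** An in-neighbour and an out-neighbour of (a,b) are opposite corners of a square with corner
    (a,b). Raising (a,b) shifts the coefficient of that diagonal by one, the arrow given by the path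
    through (a,b). *)
Lemma height_net_raise h a b x y z w : 
  (0 < b)%N -> (0 < y)%N -> (0 < w)%N ->
  ((x == a) && (y == b)) = false -> ((z == a) && (w == b)) = false ->
  height_net (raise h a b) x y z w = height_net h x y z w
  + (in_neighbor a b x y)%:Z * (out_neighbor a b z w)%:Z
  - (in_neighbor a b z w)%:Z * (out_neighbor a b x y)%:Z.
Proof.
move=> b0 y0 w0 xy zw; rewrite /height_net !half_net_raise //.
rewrite /in_neighbor /out_neighbor.
set F := half_net _ _ _ _ _; set G := half_net _ _ _ _ _.
have E (p q : bool) : p%:Z * q%:Z = (p && q)%:Z by case: p q => [] [].
rewrite !E.
have [/andP[/eqP ex /eqP ey]|N1] := boolP ((x == a.+1) && (y.+1 == b)).
  by subst x b; decide_bools; lia.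
have [/andP[/eqP ex /eqP ey]|N2] := boolP ((x.+1 == a) && (y == b.+1)).
  by subst a y; decide_bools; lia.
have [/andP[/eqP ex /eqP ey]|N3] := boolP ((x == a) && (y == b.+1)).
  by subst a y; decide_bools; lia.
have [/andP[/eqP ex /eqP ey]|N4] := boolP ((x == a) && (y.+1 == b)).
  by subst a b; decide_bools; lia.
by decide_bools; lia.
Qed.

(** Raising shifts each slope at (a,b) by one, hence each row or column coefficient by two, from 1
    to -1 or back. *)
Lemma height_net_raise_self h a b x y : raisable n h a b ->
  (0 < x)%N -> (0 < y)%N -> (x + y < n)%N ->
  ((x == a) && (y == b)) = false ->
  height_net (raise h a b) x y a b = - height_net h x y a b.
Proof.
move=> H x0 y0 xy N; have [[a0 b0 _ _] _] := H.
have {xy} := height_net_raisable H x0 y0 xy.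
suff -> : height_net (raise h a b) x y a b = height_net h x y a b
   - ((in_neighbor a b x y)%:Z - (out_neighbor a b x y)%:Z) *+ 2.
  by move=> ->; ring.
rewrite /height_net /in_neighbor /out_neighbor.
have [/andP[/eqP ex /eqP ey]|N1] := boolP ((x == a.+1) && (y.+1 == b)).
  by subst x b; rewrite /half_net /raise; decide_bools; lia.
have [/andP[/eqP ex /eqP ey]|N2] := boolP ((x.+1 == a) && (y == b.+1)).
  by subst a y; rewrite /half_net /raise; decide_bools; lia.
have [/andP[/eqP ex /eqP ey]|N3] := boolP ((x == a) && (y == b.+1)).
  by subst a y; rewrite /half_net /raise; decide_bools; lia.
have [/andP[/eqP ex /eqP ey]|N4] := boolP ((x == a) && (y.+1 == b)).
  by subst a b; rewrite /half_net /raise; decide_bools; lia.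
have [/andP[/eqP ex /eqP ey]|N5] := boolP ((a == x.+1) && (b == y)).
  by subst a b; rewrite /half_net /raise; decide_bools; lia.
have [/andP[/eqP ex /eqP ey]|N6] := boolP ((x == a.+1) && (y == b)).
  by subst x b; rewrite /half_net /raise; decide_bools; lia.
have [/andP[/eqP ex /eqP ey]|N7] := boolP ((a == x.+1) && (y == b.+2)).
  by subst a y; rewrite /half_net /raise; decide_bools; lia.
have [/andP[/eqP ex /eqP ey]|N8] := boolP ((x == a.+1) && (b == y.+2)).
  by subst x b; rewrite /half_net /raise; decide_bools; lia.
by rewrite /half_net /raise; decide_bools; lia.
Qed.

(* The indicator function of an initial interval of the row of (x,y), attached
   to the edge between (x,y) and (x+1,y-1).  For x = 0, which is the end of the
   row, both cases agree. *)
Definition level h (x y i : nat) : bool :=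
  (i <= (if h x y == h x.+1 y.-1 then x else 0) + h x.+1 y.-1)%N.

Definition frame_net h (x y i : nat) : int :=
  (level h x y i)%:Z - (level h x.-1 y.+1 i)%:Z.

(** With h = h(a,b), the intervals at the edges to (a+1,b-1) and (a-1,b+1) end at a + h and h.
    Raising exchanges flat edge and step, so the ends become h and (a-1) + (h+1). *)
Lemma level_raise h a b x y i : raisable n h a b -> (0 < y)%N ->
  level (raise h a b) x y i =
  if (x == a) && (y == b) then level h a.-1 b.+1 i
  else if (x.+1 == a) && (y == b.+1) then level h a b i
  else level h x y i.
Proof.
move=> [[a0 b0 ab lt] [e1 e2 e3 e4]] y0; rewrite /level /raise.
have [[-> ->]|N] := altP (@eqP _ (x, y) (a, b)).
  rewrite !eqxx /= prednK // e1.
  have -> : (a.+1 == a) = false by lia.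
  rewrite addn0 addn1 gtn_eqF //.
  have [a1|a1] := ltnP 1 a; first by rewrite e3 // gtn_eqF.
  by rewrite (_ : a.-1 = 0%N) ?if_same //; lia.
have {N}-> : (x == a) && (y == b) = false by move: N; rewrite xpair_eqE; lia.
have [[ex ey]|N] := altP (@eqP _ (x.+1, y) (a, b.+1)).
  subst a y; rewrite !eqxx /= addn0 addn1 e1 !eqxx.
  have [x0|x0] := ltnP 0 x; first by rewrite e3 // eqxx; lia.
  have -> : x = 0%N by lia.
  by rewrite if_same; lia.
have {}N : (x.+1 == a) && (y.-1 == b) = false by move: N; rewrite xpair_eqE; lia.
have -> : (x.+1 == a) && (y == b.+1) = false by lia.
by rewrite N !addn0.
Qed.

Lemma frame_net_raisable_ge0 h a b i : raisable n h a b -> 0 <= frame_net h a b i.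
Proof.
move=> [[a0 b0 ab lt] [e1 e2 e3 e4]]; rewrite /frame_net /level /= prednK // e1.
rewrite eqxx; have [a1|a1] := ltnP 1 a; first by rewrite e3 // gtn_eqF //; lia.
by rewrite (_ : a.-1 = 0%N) ?if_same; lia.
Qed.

Lemma frame_net_raise_self h a b i : raisable n h a b ->
  frame_net (raise h a b) a b i = - frame_net h a b i.
Proof.
move=> H; have [[a0 b0 _ _] _] := H; rewrite /frame_net !(level_raise _ _ H) //.
rewrite !eqxx /= prednK // eqxx; have -> : (a.-1 == a) = false by lia.
by rewrite opprB.
Qed.

(** A row neighbour shares one edge with (a,b), so the swap replaces one of its two intervals and
    adds the c-vector of (a,b). *)
Lemma frame_net_raise h a b x y i : raisable n h a b -> (0 < x)%N -> (0 < y)%N ->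
  ((x == a) && (y == b)) = false ->
  frame_net (raise h a b) x y i =
  frame_net h x y i + (in_neighbor a b x y)%:Z * frame_net h a b i.
Proof.
move=> H x0 y0 N; have [[a0 b0 _ _] _] := H.
rewrite /frame_net !(level_raise _ _ H) // N prednK // eqSS N /in_neighbor.
have [[ex ey]|N1] := altP (@eqP _ (x.+1, y) (a, b.+1)).
  subst a y; rewrite !eqxx orbT /=.
  have -> : (x.-1 == x.+1) = false by lia.
  by rewrite /=; lia.
have -> : (x.+1 == a) && (y == b.+1) = false by move: N1; rewrite xpair_eqE; lia.
have [[ex ey]|N2] := altP (@eqP _ (x, y.+1) (a.+1, b)).
  by subst b x; rewrite !eqxx /=; lia.
have -> : (x == a.+1) && (y.+1 == b) = false by move: N2; rewrite xpair_eqE; lia.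
have -> : (x.-1 == a) && (y.+1 == b) = false by move: N2; rewrite xpair_eqE; lia.
by rewrite mul0r addr0.
Qed.

End Arrows.

(** * The triangle quiver *)

Section Triangle.
Variable n : nat.
Implicit Types (u v w : triangle n) (h : nat -> nat -> nat).
Local Notation a_ := (@coord_a n).
Local Notation b_ := (@coord_b n).
Local Notation unf := (@triangle_unfrozen n).

Lemma coord_sum u : (a_ u + b_ u + coord_c u)%N = n.
Proof. exact/eqP/(valP u). Qed.

Lemma coord_eq u v : (u == v) = (a_ u == a_ v) && (b_ u == b_ v).
Proof.
apply/eqP/andP => [-> //|[/eqP ea /eqP eb]]; apply/val_inj.
have ec : coord_c u = coord_c v by have := coord_sum u; have := coord_sum v; lia.
move: ea eb ec; rewrite /coord_a /coord_b /coord_c.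
case: (val u) (val v) => [[a b] c] [[a' b'] c'] /= ea eb ec.
by congr (_, _, _); apply: val_inj.
Qed.

Lemma triangle_unfrozenE u :
  unf u = [&& (0 < a_ u)%N, (0 < b_ u)%N & (a_ u + b_ u < n)%N].
Proof. by rewrite /triangle_unfrozen; have := coord_sum u; lia. Qed.

Lemma triangle_vertex (a b : nat) :
  (a + b <= n)%N -> exists u, a_ u = a /\ b_ u = b.
Proof.
move=> ab.
have la : (a < n.+1)%N by lia.
have lb : (b < n.+1)%N by lia.
have lc : (n - (a + b) < n.+1)%N by lia.
have sum : ((Ordinal la, Ordinal lb, Ordinal lc).1.1 +
  (Ordinal la, Ordinal lb, Ordinal lc).1.2 +
  (Ordinal la, Ordinal lb, Ordinal lc).2 == n)%N by rewrite /= subnKC.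
by exists (exist _ (Ordinal la, Ordinal lb, Ordinal lc) sum).
Qed.

Lemma conf3_no_two_cycles : no_two_cycles (conf3_quiver n).
Proof.
move=> u v /=; rewrite orbC; case: (unf v || unf u) => /=; last by left.
have := coord_sum u; have := coord_sum v; rewrite /triangle_arrow; lia.
Qed.

Definition height_quiver (P : ice_quiver (triangle n + triangle n)%type) h :=
  [/\ no_two_cycles P,
      forall u, unfrozen P (inl u) = unf u,
      forall u v, unf u -> unf v -> net P (inl u) (inl v) =
        height_net h (a_ u) (b_ u) (a_ v) (b_ v)
    & forall u w, unf u -> net P (inl u) (inr w) =
        if (a_ u + b_ u == a_ w + b_ w)%N
        then frame_net h (a_ u) (b_ u) (a_ w) else 0].

Lemma height_quiver0 : height_quiver (framed (conf3_quiver n)) (fun _ _ => 0%N).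
Proof.
split=> //; first exact: no_two_cycles_framed conf3_no_two_cycles.
- move=> u v uu uv; rewrite /net /= uu uv /= /triangle_arrow.
  have half0 a b x y : half_net (fun _ _ => 0%N) a b x y =
      ((a == x.+1) && (y == b.+1))%:Z + ((a == x) && (b == y.+1))%:Z
      + ((x == a.+1) && (y == b))%:Z.
    by rewrite /half_net !subrr mul0rn !subr0 !mulr1 mulr0 !addr0.
  rewrite /height_net !half0.
  have := coord_sum u; have := coord_sum v.
  rewrite /triangle_arrow; move: uu uv; rewrite !triangle_unfrozenE.
  set a := a_ u; set b := b_ u; set a' := a_ v; set b' := b_ v.
  set c := coord_c u; set c' := coord_c v => uu uv su sv.
  have -> : [|| [&& a == a'.+1, b' == b.+1 & c' == c],
    [&& a' == a, b == b'.+1 & c' == c.+1] | [&& a' == a.+1, b' == b & c == c'.+1]]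
   = [|| (a == a'.+1) && (b' == b.+1), (a == a') && (b == b'.+1) |
     (a' == a.+1) && (b' == b)] by lia.
  have -> : [|| [&& a' == a.+1, b == b'.+1 & c == c'],
    [&& a == a', b' == b.+1 & c == c'.+1] | [&& a == a'.+1, b == b' & c' == c.+1]]
   = [|| (a' == a.+1) && (b == b'.+1), (a' == a) && (b' == b.+1) |
     (a == a'.+1) && (b == b')] by lia.
  (* The three arrow directions exclude each other, so the indicator of their disjunction is a
     sum. *)
  have E (p q r : bool) : ~~ (p && q) -> ~~ (p && r) -> ~~ (q && r) ->
    [|| p, q | r]%:Z = p%:Z + q%:Z + r%:Z by case: p q r => [] [] [].
  by rewrite !E; lia.
(* At height 0 the intervals end at a and a - 1; their difference is the indicator of a. *)
- move=> u w uu; rewrite /net /= uu andbT subr0 coord_eq /frame_net /level /=.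
  rewrite !addn0; have := uu; rewrite triangle_unfrozenE => /and3P[a0 b0 ab].
  by case: (_ + _ =P _)%N => s; lia.
Qed.

Lemma height_quiver_green P h v :
  height_quiver P h -> raisable n h (a_ v) (b_ v) -> green P v.
Proof.
move=> [P2 uP _ PC] H w; have := P2 (inl v) (inr w) => -[] // e.
have uv : unf v by rewrite triangle_unfrozenE; have [[-> -> ->]] := H.
have := PC v w uv; have := frame_net_raisable_ge0 (a_ w) H.
by rewrite /net e; move: (arr P _ _) => x; case: ifP => _; lia.
Qed.

Lemma height_quiver_raise P h v : height_quiver P h ->
  raisable n h (a_ v) (b_ v) ->
  height_quiver (quiver_mutation P (inl v)) (raise h (a_ v) (b_ v)).
Proof.
move=> [P2 uP PB PC] H; have [[a0 b0 ab _] _] := H.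
have uv : unf v by rewrite triangle_unfrozenE a0 b0.
have e x y : (inl x == inl y :> triangle n + triangle n) = (x == y) by [].
have nv u : unf u -> net P (inl u) (inl v) =
    (in_neighbor (a_ v) (b_ v) (a_ u) (b_ u))%:Z -
    (out_neighbor (a_ v) (b_ v) (a_ u) (b_ u))%:Z.
  move=> uu; rewrite PB //; move: uu; rewrite triangle_unfrozenE => /and3P[*].
  exact: height_net_raisable H _ _ _.
have maxin u : unf u ->
    Num.max 0 (net P (inl u) (inl v)) = (in_neighbor (a_ v) (b_ v) (a_ u) (b_ u))%:Z.
  by move=> uu; rewrite nv // /in_neighbor /out_neighbor; lia.
have maxout u : unf u ->
    Num.max 0 (net P (inl v) (inl u)) = (out_neighbor (a_ v) (b_ v) (a_ u) (b_ u))%:Z.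
  by move=> uu; rewrite netC nv // /in_neighbor /out_neighbor; lia.
split=> //.
- exact: no_two_cycles_mutation.
- move=> u w uu uw; rewrite net_mutation //= ?uP ?uu // !e.
  have := uu; rewrite triangle_unfrozenE => /and3P[ua ub uab].
  have := uw; rewrite triangle_unfrozenE => /and3P[wa wb wab].
  have [->|uv'] := eqVneq u v; have [->|wv'] := eqVneq w v.
  + by rewrite /net /height_net !subrr oppr0.
  + rewrite netC opprK height_netC (height_net_raise_self H) ?opprK ?PB //.
    by apply/negbTE; rewrite -coord_eq.
  + rewrite (height_net_raise_self H) ?PB //.
    by apply/negbTE; rewrite -coord_eq.
  rewrite height_net_raise //; last 2 first.
    by apply/negbTE; rewrite -coord_eq.
    by apply/negbTE; rewrite -coord_eq.
  by rewrite /= !maxin // !maxout // PB.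
- move=> u w uu; rewrite net_mutation //= ?uP ?uu // e orbF.
  have := uu; rewrite triangle_unfrozenE => /and3P[ua ub uab].
  have [->|uv'] := eqVneq u v.
    by rewrite PC // (frame_net_raise_self _ H); case: ifP; rewrite ?oppr0.
  rewrite (frame_net_raise _ H) //; last first.
    by apply/negbTE; rewrite -coord_eq.
  have f0 := frame_net_raisable_ge0 (a_ w) H.
  rewrite /= maxin // maxout // [net P (inr w) _]netC !PC //.
  (* In-neighbours of v lie in its row, so the c-vectors of other rows do not change. *)
  have [row|row] := eqVneq (a_ v + b_ v)%N (a_ w + b_ w)%N.
    rewrite (max_r f0) (max_l (_ : - _ <= 0)) ?oppr_le0 // mul0r subr0 -row.
    case: eqP => // ruv; rewrite add0r (_ : in_neighbor _ _ _ _ = false) ?mul0r //.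
    by rewrite /in_neighbor; lia.
  rewrite oppr0 maxxx mulr0 !addr0 ?subr0 ?addr0.
  case: eqP => // ruw; rewrite (_ : in_neighbor _ _ _ _ = false) ?mul0r ?addr0 //.
  by rewrite /in_neighbor; lia.
Qed.

(** At full height the two intervals at (a,b) end at b - 1 and b, so its c-vector is minus the basis
    vector of (b,a). *)
Lemma height_quiver_red P h : admissible n h -> height_quiver P h ->
  (forall a b, (0 < a)%N -> (0 < b)%N -> (a + b < n)%N -> h a b = b) ->
  forall u, unf u -> red P u.
Proof.
move=> [h0 _ _ _] [P2 _ _ PC] full u uu w.
have := P2 (inl u) (inr w) => -[] // e.
have := PC u w uu; rewrite /net e subr0; move: (arr P _ _) => x.
move: uu; rewrite triangle_unfrozenE => /and3P[a0 b0 ab].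
case: ifP => _; last by lia.
have hb : h (a_ u).+1 (b_ u).-1 = (b_ u).-1.
  have [b1|b1] := leqP (b_ u) 1; first by rewrite (_ : (b_ u).-1 = 0%N) ?h0; lia.
  by rewrite full; lia.
rewrite /frame_net /level /= prednK // hb full //.
have -> : (b_ u == (b_ u).-1) = false by lia.
have [a1|a1] := ltnP 1 (a_ u); first by rewrite full ?gtn_eqF //; lia.
by rewrite (_ : (a_ u).-1 = 0%N) ?if_same; lia.
Qed.

Lemma maximal_green_from_height N : forall P h,
  admissible n h -> height_quiver P h ->
  (\sum_(u | unf u) (b_ u - h (a_ u) (b_ u)) < N)%N ->
  exists ks, maximal_green_from P ks.
Proof.
elim: N => // N IHN P h adm PH hN.
pose p := [pred u | unf u && (h (a_ u) (b_ u) < b_ u)%N].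
have [v pv|full] := pickP p; last first.
  exists [::] => u; have [_ -> _ _] := PH => uu.
  apply: (height_quiver_red adm PH) uu => a b a0 b0 ab.
  have [w [ea eb]] := triangle_vertex (ltnW ab); have := full w.
  rewrite /= triangle_unfrozenE ea eb a0 b0 ab /=.
  by have [_ hb _ _] := adm; have := hb a b a0 b0 ab; lia.
(* This is 2h - b, shifted by n to stay in the natural numbers. *)
pose F u := (2 * h (a_ u) (b_ u) + (n - b_ u))%N.
case: (arg_minnP F pv) => {pv}{}v /andP[uv lt] Fmin.
have := uv; rewrite triangle_unfrozenE => /and3P[a0 b0 ab].
have H : raisable n h (a_ v) (b_ v).
  apply: raisable_min => // x y x0 y0 xy hxy.
  have [u [eu eu']] := triangle_vertex (ltnW xy).
  have := Fmin u; rewrite /= triangle_unfrozenE /F eu eu' x0 y0 xy hxy.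
  by move=> /(_ isT); lia.
have [ks mks] : exists ks, maximal_green_from (quiver_mutation P (inl v)) ks.
  apply: (IHN _ (raise h (a_ v) (b_ v))).
  - exact: admissible_raise.
  - exact: height_quiver_raise.
  move: hN; rewrite (bigD1 v) // [X in _ -> (X < _)%N](bigD1 v) //=.
  rewrite {1}/raise !eqxx /=.
  rewrite [X in _ -> (_ + X < _)%N](eq_bigr (fun u => (b_ u - h (a_ u) (b_ u))%N)).
    by set S := bigop _ _ _; lia.
  move=> u /andP[_ uv']; rewrite /raise.
  by rewrite -coord_eq (negPf uv') addn0.
exists (v :: ks); split=> //; first by have [_ ->] := PH.
exact: height_quiver_green PH H.
Qed.

Lemma conf3_maximal_green :
  exists ks, maximal_green_sequence (conf3_quiver n) ks.
Proof.
apply: (maximal_green_from_height _ height_quiver0 (ltnSn _)).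
by split=> // *; lia.
Qed.

End Triangle.

Theorem theorem5 (R : realType) (n : nat) (hn : (1 <= n)%N) :
  (exists ks : seq (triangle n), maximal_green_sequence (conf3_quiver n) ks) /\
  large_cluster_complex R (conf3_quiver n).
Proof.
have [ks mks] := conf3_maximal_green n; split; first by exists ks.
have [f [f_a _]] := triangle_vertex (leq0n n : (0 + 0 <= n)%N).
apply: (@maximal_green_sequence_large R _ _ (@conf3_no_two_cycles n) ks f _ mks).
by rewrite /= /triangle_unfrozen f_a.
Qed.
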